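(* In the $5x+1$ repeated random walk model, for a realization $\omega$ let $$S_\infty(\omega)=\{n\ge1:\ e^{Z_{k,n}}<1\ \text{for some }k\ge1\},\qquad \pi_5(x;\omega)=\#\{1\le n\le x:\ n\in S_\infty(\omega)\}.$$ Then for almost every $\omega$, $$\lim_{x\to\infty}\frac{\log\pi_5(x;\omega)}{\log x}=\eta_{5,RRW},\qquad \eta_{5,RRW}=1-\theta_{5,RRW},$$ where $\theta_{5,RRW}$ is the unique positive solution of $\tfrac12\big(2^\theta+(\tfrac25)^\theta\big)=1$.
   Context: The $5x+1$ repeated random walk (RRW) model: for each integer $n\ge1$ take an independent sequence $(\delta_{i,n})_{i\ge1}$ of i.i.d. Bernoulli random variables with $\mathbb P[\delta=0]=\mathbb P[\delta=1]=\tfrac12$ (all sequences mutually independent), put $W_{i,n}=-\log 2+\delta_{i,n}\log 5$, and define $Z_{0,n}=\log n$, $Z_{k,n}=\log n+W_{1,n}+\cdots+W_{k,n}$. A realization is $\omega=\{Z_{k,n}\}$. *)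

(* Defs.v *)
From HB Require Import structures.
From mathcomp Require Import all_boot all_order all_algebra finmap.
From mathcomp Require Import all_classical all_reals all_analysis.

Set Implicit Arguments.
Unset Strict Implicit.
Unset Printing Implicit Defensive.

Import Order.TTheory GRing.Theory Num.Theory.
Import numFieldNormedType.Exports.

Local Open Scope classical_set_scope.
Local Open Scope ring_scope.

Definition mutually_independent (d d' : measure_display) (T : measurableType d)
    (T' : measurableType d') (R : realType) (P : probability T R)
    (I : choiceType) (D : set I) (X : I -> T -> T') : Prop :=
  forall (J : {fset I}) (B : I -> set T'),
    [set` J] `<=` D ->
    (forall i, i \in J -> measurable (B i)) ->
    P (\bigcap_(i in [set` J]) (X i @^-1` B i)) =
      (\prod_(i <- J) P (X i @^-1` B i))%E.

Section RRW5.
Context (d : measure_display) (T : measurableType d) (R : realType)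
  (P : probability T R).

(* [delta i n] is constrained only for [1 <= i] and [1 <= n]; independence
   is over the whole doubly-indexed family. *)
Definition RRW5_model (delta : nat -> nat -> {RV P >-> R}) : Prop :=
  (forall i n, (1 <= i)%N -> (1 <= n)%N ->
     P (delta i n @^-1` [set 0]) = (2^-1)%:E /\
     P (delta i n @^-1` [set 1]) = (2^-1)%:E) /\
  mutually_independent P
    [set p : nat * nat | (1 <= p.1)%N /\ (1 <= p.2)%N]
    (fun p => delta p.1 p.2 : T -> R).

Variable delta : nat -> nat -> {RV P >-> R}.

Definition RRW5_W (i n : nat) (w : T) : R := - ln 2 + delta i n w * ln 5.

Definition RRW5_Z (k n : nat) (w : T) : R :=
  ln n%:R + \sum_(1 <= i < k.+1) RRW5_W i n w.

Definition RRW5_S_infty (w : T) : set nat :=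
  [set n | (1 <= n)%N /\ exists k, (1 <= k)%N /\ expR (RRW5_Z k n w) < 1].

(* The set being counted is bounded by [x], so [fset_set] is its genuine
   finite version. *)
Definition RRW5_pi (x : R) (w : T) : nat :=
  #|` fset_set [set n | (1 <= n)%N /\ n%:R <= x /\ RRW5_S_infty w n] |.

End RRW5.

Definition RRW5_theta_eq (R : realType) (t : R) : Prop :=
  0 < t /\ 2^-1 * (2 `^ t + (2 / 5) `^ t) = 1.

(* Main.v *)
(** The probability [p_n] that the walk started at [ln n] ever becomes negative
    satisfies [2^-theta * n^-theta <= p_n <= n^-theta]: since
    [step_mgf theta = 1], [expR (- theta * Z_k)] is a martingale, the steps down
    have size [ln 2], and [Z_k] tends to infinity.  Walks with distinct starting
    points are independent, so the number of [n <= N] that reach the negative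
    half-line has mean of order [N^(1 - theta)] and variance at most its mean.
    Chebyshev's inequality and Borel-Cantelli along [N = 2^j] pin the count to
    within a factor of its mean, and monotonicity fills the gaps between
    consecutive powers of two. *)

Require Import Defs.
From HB Require Import structures.
From mathcomp Require Import all_boot all_order all_algebra finmap.
From mathcomp Require Import all_classical all_reals all_analysis.
From mathcomp Require Import measurable_realfun ring lra.

Set Implicit Arguments.
Unset Strict Implicit.
Unset Printing Implicit Defensive.

Import Order.TTheory GRing.Theory Num.Theory.
Import numFieldNormedType.Exports.

Local Open Scope classical_set_scope.
Local Open Scope ring_scope.

(** * One step of the walk: its moment generating function and the hitting recursion *)

Section step_mgf.
Context {R : realType}.
Implicit Types s t z : R.

(** This is the mean of [expR (- t * W)] for one step [W], which is [- ln 2] or [- ln 2 + ln 5] with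
    probability one half each. *)
Definition step_mgf t : R := 2^-1 * (2 `^ t + (2 / 5) `^ t).

Lemma ln_two_fifths : ln (2 / 5 : R) = ln 2 - ln 5.
Proof. by rewrite lnM ?posrE ?invr_gt0// lnV ?posrE. Qed.

Lemma powR2E t : 2 `^ t = expR (t * ln 2).
Proof. by rewrite /powR pnatr_eq0. Qed.

Lemma powR_two_fifthsE t : (2 / 5) `^ t = expR (t * (ln 2 - ln 5)).
Proof. by rewrite /powR gt_eqF ?divr_gt0// ln_two_fifths. Qed.

(** Exponentials are eigenfunctions of averaging over one step. At a root of [step_mgf t = 1] this
    makes [expR (- t * z)] harmonic, which drives both bounds on [hitp]. *)
Lemma step_mgfE t z :
  2^-1 * (expR (- t * (z - ln 2)) + expR (- t * (z - ln 2 + ln 5))) =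
  step_mgf t * expR (- t * z).
Proof.
rewrite /step_mgf powR2E powR_two_fifthsE -mulrA; congr (_ * _).
by rewrite mulrDl -!expRD; congr (expR _ + expR _); ring.
Qed.

(** The tangent to [expR] at [u * a] is evaluated at [a] and at 0; with weights [u] and [1 - u] the
    linear terms cancel. Strictness comes from the endpoint 0, since [u * a] is nonzero. *)
Lemma expR_lt_chord (a u : R) : a != 0 -> 0 < u < 1 ->
  expR (u * a) < 1 - u + u * expR a.
Proof.
move=> a0 /andP[u0 u1].
have t1 : expR (u * a) * (1 + (1 - u) * a) <= expR a.
  have -> : expR a = expR (u * a) * expR ((1 - u) * a).
    by rewrite -expRD; congr expR; ring.
  by rewrite ler_pM2l ?expR_gt0// expR_ge1Dx.
have t0 : expR (u * a) * (1 - u * a) < 1.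
  have {2}<- : expR (u * a) * expR (- (u * a)) = 1.
    by rewrite -expRD subrr expR0.
  by rewrite ltr_pM2l ?expR_gt0// expR_gt1Dx// oppr_eq0 mulf_neq0// gt_eqF.
have : (1 - u) * (expR (u * a) * (1 - u * a)) < (1 - u) * 1.
  by rewrite ltr_pM2l// subr_gt0.
have : u * (expR (u * a) * (1 + (1 - u) * a)) <= u * expR a.
  by rewrite ler_pM2l.
set e := expR (u * a); lra.
Qed.

Lemma ln2_gt0 : 0 < ln 2 :> R.
Proof. by rewrite ln_gt0// ltr1n. Qed.

Lemma ln2_lt_ln5 : ln 2 < ln 5 :> R.
Proof. by rewrite ltr_ln ?posrE// ltr_nat. Qed.

(** Strict convexity: [step_mgf] equals 1 both at 0 and at [t]. Each of the two exponentials is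
    compared with its chord at the fraction [s / t]. *)
Lemma step_mgf_lt1 s t : step_mgf t = 1 -> 0 < s < t -> step_mgf s < 1.
Proof.
rewrite /step_mgf !powR2E !powR_two_fifthsE => t1 /andP[s0 st].
have t0 : 0 < t by apply: lt_trans st.
have u01 : 0 < s / t < 1 by rewrite divr_gt0//= ltr_pdivrMr// mul1r.
have ln25 := ln2_lt_ln5; have ln20 := ln2_gt0.
have a0 : t * ln 2 != 0 by rewrite mulf_neq0 ?gt_eqF.
have b0 : t * (ln 2 - ln 5) != 0.
  by rewrite mulf_neq0 ?(gt_eqF t0) ?subr_eq0 ?lt_eqF.
have := expR_lt_chord a0 u01; have := expR_lt_chord b0 u01.
rewrite !mulrA divfK ?gt_eqF//.
have : s / t * (2^-1 * (expR (t * ln 2) + expR (t * (ln 2 - ln 5)))) = s / t.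
  by rewrite t1 mulr1.
set u := s / t; lra.
Qed.

Lemma continuous_step_mgf : continuous step_mgf.
Proof.
have -> : step_mgf =
    fun t => 2^-1 * (expR (t * ln 2) + expR (t * (ln 2 - ln 5))).
  by apply/funext => t; rewrite /step_mgf powR2E powR_two_fifthsE.
move=> t; apply: cvgMr; apply: cvgD.
  by apply: continuous_comp; [apply: mulrr_continuous|apply: continuous_expR].
by apply: continuous_comp; [apply: mulrr_continuous|apply: continuous_expR].
Qed.

Lemma powR_quarter_lt (a b : R) : 0 < a -> 0 < b ->
  a < b ^+ 4 -> a `^ (4^-1) < b.
Proof.
move=> a0 b0 ab; rewrite -(@ltr_pXn2r _ 4)// ?nnegrE ?powR_ge0 ?ltW//.
by rewrite -powR_mulrn ?powR_ge0// -powRrM mulVf ?pnatr_eq0// powRr1// ltW.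
Qed.

(** As 0 already solves [step_mgf t = 1], the search for a positive root must start where the value
    is below 1. The fourth roots of 2 and 2/5 are below 119/100 and 4/5, whose average is
    199/200. *)
Lemma step_mgf_quarter_lt1 : step_mgf 4^-1 < 1.
Proof.
have := @powR_quarter_lt 2 (119 / 100).
have := @powR_quarter_lt (2/5) (4 / 5).
rewrite /step_mgf; set x := _ `^ _; set y := _ `^ _ => hx hy.
have : x < 4/5 by apply: hx; lra.
have : y < 119/100 by apply: hy; lra.
lra.
Qed.

(** The value 6/5 at 1 exceeds 1, so the root lies below 1 and the exponent [1 - t] is positive. *)
Lemma ex_step_mgf_eq1 : exists2 t : R, 0 < t < 1 & step_mgf t = 1.
Proof.
have f1 : step_mgf 1 = 6 / 5 by rewrite /step_mgf !powRr1 ?divr_ge0//; lra.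
have fq := step_mgf_quarter_lt1.
have [|||c] := @IVT _ step_mgf 4^-1 1 1; first by lra.
- by apply: continuous_subspaceT; apply: continuous_step_mgf.
- by rewrite f1 ge_min le_max; lra.
rewrite in_itv/= => /andP[c4 c1] fc; exists c => //.
have c0 : 0 < c by lra.
rewrite c0/= lt_neqAle c1 andbT.
by apply/eqP => c1'; move: fc; rewrite c1' f1; lra.
Qed.

Lemma unique_step_mgf_eq1 s t : 0 < s -> 0 < t ->
  step_mgf s = 1 -> step_mgf t = 1 -> s = t.
Proof.
move=> s0 t0 s1 t1; have [st|ts|//] := ltgtP s t.
  by have := @step_mgf_lt1 _ _ t1 (introT andP (conj s0 st)); rewrite s1 ltxx.
by have := @step_mgf_lt1 _ _ s1 (introT andP (conj t0 ts)); rewrite t1 ltxx.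
Qed.

(* The probability that the walk started at [z] is negative at some time
   [k <= K]. *)
Fixpoint hitp K z : R :=
  if z < 0 then 1 else
  if K is K'.+1 then 2^-1 * (hitp K' (z - ln 2) + hitp K' (z - ln 2 + ln 5))
  else 0.

Lemma hitp_ge0 K z : 0 <= hitp K z.
Proof.
by elim: K z => [|K IH] z /=; case: ifP => // _; rewrite mulr_ge0// addr_ge0.
Qed.

(** The exponential is at least 1 on the negative half-line and is preserved by averaging over a
    step, so it dominates the recursion at every horizon. *)
Lemma hitp_le t K z : 0 <= t -> step_mgf t = 1 -> hitp K z <= expR (- t * z).
Proof.
move=> t0 t1; elim: K z => [|K IH] z /=; case: ifPn => [z0|_].
- by rewrite -expR0 ler_expR mulNr oppr_ge0 mulr_ge0_le0// ltW.
- exact: expR_ge0.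
- by rewrite -expR0 ler_expR mulNr oppr_ge0 mulr_ge0_le0// ltW.
- have -> : expR (- t * z) = step_mgf t * expR (- t * z) by rewrite t1 mul1r.
  by rewrite -step_mgfE ler_pM2l ?invr_gt0// lerD.
Qed.

(* The walk never jumps below [- ln 2], so the martingale [expR (- t * Z)] is at
   most [2 `^ t] on hitting; off the hitting event it is dominated by
   [expR (- s * Z)], whose mean decays geometrically. *)
Lemma hitp_ge s t K z : 0 <= s <= t -> step_mgf t = 1 -> - ln 2 <= z ->
  expR (- t * z) <= 2 `^ t * hitp K z + step_mgf s ^+ K * expR (- s * z).
Proof.
move=> /andP[s0 st] t1; have t0 := le_trans s0 st.
have neg z' : - ln 2 <= z' -> expR (- t * z') <= 2 `^ t.
  move=> z2; rewrite powR2E ler_expR mulNr -mulrN ler_wpM2l//; lra.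
have f0 : 0 <= step_mgf s by rewrite mulr_ge0 ?addr_ge0 ?powR_ge0 ?invr_ge0.
elim: K z => [|K IH] z /= z2; case: ifPn => [z0|].
- by rewrite mulr1 (le_trans (neg _ z2))// lerDl mulr_ge0 ?expR_ge0.
- rewrite -leNgt => z0; rewrite mulr0 add0r expr0 mul1r ler_expR !mulNr lerN2.
  by rewrite ler_wpM2r.
- by rewrite mulr1 (le_trans (neg _ z2))// lerDl mulr_ge0 ?expR_ge0 ?exprn_ge0.
rewrite -leNgt => z0; have := ln2_gt0; have := ln2_lt_ln5 => l25 l2.
have -> : expR (- t * z) = step_mgf t * expR (- t * z) by rewrite t1 mul1r.
rewrite -step_mgfE exprSr -mulrA -step_mgfE.
have := IH (z - ln 2); have := IH (z - ln 2 + ln 5).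
move=> /(_ ltac:(lra)) h1 /(_ ltac:(lra)) h2.
set x := step_mgf s ^+ K in h1 h2 *; set a := 2 `^ t in h1 h2 *.
lra.
Qed.

End step_mgf.

(** * Coin cylinders and independence from the past *)

Section walk.
Context (d : measure_display) (T : measurableType d) (R : realType)
  (P : probability T R) (delta : nat -> nat -> {RV P >-> R}).
Hypothesis hdelta : RRW5_model delta.
Implicit Types (E : set T) (L : seq (nat * nat)) (b : nat * nat -> bool).

Local Notation W := (RRW5_W delta).

(** The independence hypothesis of the model enters only through the probabilities of these
    cylinders. *)
Definition cyl L b : set T :=
  [set w | forall p, p \in L -> delta p.1 p.2 w = (b p)%:R].

Lemma cylE L b : cyl L b =
  \bigcap_(p in [set` [fset p in L]%fset]) (delta p.1 p.2 @^-1` [set (b p)%:R]).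
Proof.
apply/seteqP; split => w /= H p; first by move=> /=; rewrite inE; apply: H.
by move=> pL; apply: H => /=; rewrite inE.
Qed.

Lemma measurable_delta_eq i n (r : R) : measurable (delta i n @^-1` [set r]).
Proof. by rewrite -[X in measurable X]setTI; apply: measurable_funPT. Qed.

Lemma measurable_cyl L b : measurable (cyl L b).
Proof.
rewrite cylE; apply: fin_bigcap_measurable; first exact: finite_fset.
by move=> p _; apply: measurable_delta_eq.
Qed.

Lemma P_delta i n (c : bool) : (0 < i)%N -> (0 < n)%N ->
  P (delta i n @^-1` [set c%:R]) = (2^-1)%:E.
Proof. by move=> i0 n0; have [h0 h1] := hdelta.1 i n i0 n0; case: c. Qed.

Lemma P_cyl L b : uniq L -> (forall p, p \in L -> (0 < p.1)%N /\ (0 < p.2)%N) ->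
  P (cyl L b) = (2^-1 ^+ size L)%:E.
Proof.
move=> uL L0; rewrite cylE.
have := hdelta.2 [fset p in L]%fset (fun p => [set (b p)%:R]) => /= ->.
- transitivity (\prod_(p <- [fset p in L]%fset) (2^-1 : R)%:E)%E.
    by apply: eq_big_seq => p; rewrite inE => /L0[]; apply: P_delta.
  rewrite prodEFin big_const_seq count_predT iter_mulr_1.
  by rewrite card_fseq undup_id.
- by move=> p /=; rewrite inE => /L0.
- by move=> p _; apply: measurable_set1.
Qed.

(** The real variable [delta i n] is 0 or 1 only almost surely, so the two fibres need not cover
    [T]; their masses add up to 1, hence the rest of [E] is null. *)
Lemma P_split_delta i n E : (0 < i)%N -> (0 < n)%N -> measurable E ->
  P E = (P (E `&` delta i n @^-1` [set false%:R]) +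
         P (E `&` delta i n @^-1` [set true%:R]))%E.
Proof.
move=> i0 n0 mE; set D0 := _ @^-1` [set false%:R]; set D1 := _ @^-1` _.
have mD0 : measurable D0 by apply: measurable_delta_eq.
have mD1 : measurable D1 by apply: measurable_delta_eq.
have D01 : D0 `&` D1 = set0.
  apply/seteqP; split => w // -[]; rewrite /D0 /D1/= => -> /esym/eqP.
  by rewrite oner_eq0.
rewrite -measureU//; [|exact: measurableI|exact: measurableI|]; last first.
  by rewrite setIACA setIid D01 setI0.
rewrite -setIUr.
have mD : measurable (D0 `|` D1) by apply: measurableU.
transitivity (P (E `\` (D0 `|` D1)) + P (E `&` (D0 `|` D1)))%E.
  exact: measureDI.
rewrite (_ : P (E `\` (D0 `|` D1)) = 0%E) ?add0e//.
apply/eqP; rewrite eq_le measure_ge0 andbT.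
have <- : P (~` (D0 `|` D1)) = 0%E.
  have PD : P (D0 `|` D1) = 1%E.
    transitivity (P D0 + P D1)%E; first exact: measureU.
    by rewrite !P_delta// -EFinD; congr EFin; lra.
  by rewrite probability_setC// PD subee.
rewrite setDE measureIr//; exact: measurableC.
Qed.

(** [E] is the past in a Markov argument for walk [n] at time [i]. Cylinders of later coins are
    enough to test against, because the walk reads its coins one at a time. *)
Definition indep_above E n i := forall L b, uniq L ->
  (forall p, p \in L -> (i < p.1)%N /\ p.2 = n) ->
  P (E `&` cyl L b) = (P E * (2^-1 ^+ size L)%:E)%E.

Lemma indep_above_delta E n i (c : bool) : indep_above E n i ->
  P (E `&` delta i.+1 n @^-1` [set c%:R]) = (P E * (2^-1)%:E)%E.
Proof.
move=> EI; have := EI [:: (i.+1, n)] (fun=> c) erefl.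
rewrite expr1 => <-; last by move=> p; rewrite inE => /eqP ->.
congr (P (_ `&` _)); apply/seteqP; split => w /=.
  by move=> H p; rewrite inE => /eqP ->.
by move=> /(_ (i.+1, n)); rewrite mem_head => /(_ erefl).
Qed.

(** Coin [i.+1] together with a cylinder of later coins is one longer cylinder, from which [E] is
    already independent. *)
Lemma indep_aboveS E n i (c : bool) : indep_above E n i ->
  indep_above (E `&` delta i.+1 n @^-1` [set c%:R]) n i.+1.
Proof.
move=> EI L b uL Li; rewrite (indep_above_delta _ EI) -muleA -EFinM -exprS.
have iL : (i.+1, n) \notin L.
  by apply/negP => /Li[]; rewrite ltnn.
pose b' p := if p == (i.+1, n) then c else b p.
have := EI ((i.+1, n) :: L) b'; rewrite /= iL => /(_ uL) <-; last first.
  by move=> p; rewrite inE => /predU1P[->//|/Li[/ltnW]].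
congr (P _); rewrite -setIA; congr (_ `&` _); apply/seteqP; split => w /=.
  move=> [wi wL] p; rewrite inE /b' => /predU1P[->/=|pL]; first by rewrite eqxx.
  by case: eqP => [pi|_]; [move: pL; rewrite pi (negPf iL)|exact: wL].
move=> wL; split.
  by have := wL (i.+1, n); rewrite mem_head /b' eqxx; apply.
move=> p pL; rewrite wL ?inE ?pL ?orbT// /b'.
by case: eqP => // pi; move: pL; rewrite pi (negPf iL).
Qed.

(** * Hitting events within a finite horizon *)

Fixpoint hits n K i z : set T :=
  [set w | z < 0 \/ if K is K'.+1 then hits n K' i.+1 (z + W i.+1 n w) w
                    else False].

(** The recursion copies that of [hitp], with [i] the number of coins already read and [z] the
    current position; unrolling it recovers the partial sums of the model. *)
Lemma hitsP n K i z w : hits n K i z w <->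
  exists2 k, (k <= K)%N & z + \sum_(i <= l < i + k) W l.+1 n w < 0.
Proof.
elim: K i z => [|K IH] i z /=.
  split=> [[z0|//]|[k]]; first by exists 0%N; rewrite // addn0 big_geq// addr0.
  by rewrite leqn0 => /eqP ->; rewrite addn0 big_geq// addr0 => z0; left.
split=> [[z0|/IH[k kK H]]|[[_|k kK H]]].
- by exists 0%N; rewrite // addn0 big_geq// addr0.
- by exists k.+1; rewrite // big_ltn ?addnS ?ltnS ?leq_addr// addrA -addSn.
- by rewrite addn0 big_geq// addr0; left.
right; apply/IH; exists k => //; move: H.
by rewrite big_ltn ?addnS ?ltnS ?leq_addr// addrA -addSn.
Qed.

Lemma measurable_RRW5_W i n : measurable_fun setT (W i n).
Proof.
by apply: measurable_funD => //; apply: measurable_funM.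
Qed.

Lemma measurable_hits n K i z : measurable (hits n K i z).
Proof.
have -> : hits n K i z = \bigcup_(k in `I_K.+1)
    ((fun w => z + \sum_(i <= l < i + k) W l.+1 n w) @^-1` [set` `]-oo, 0[%R]).
  apply/seteqP; split => w.
    by move=> /hitsP[k kK H]; exists k => //=; rewrite in_itv.
  by move=> [k /= kK]; rewrite in_itv/= => H; apply/hitsP; exists k.
apply: fin_bigcup_measurable; first exact: finite_II.
move=> k _; rewrite -[X in measurable X]setTI.
suff: measurable_fun setT (fun w => z + \sum_(i <= l < i + k) W l.+1 n w).
  by apply => //; apply: measurable_itv.
apply: measurable_funD => //; apply: measurable_sum => l.
exact: measurable_RRW5_W.
Qed.

(** The Markov property. A general past [E] lets the induction absorb each revealed coin, and later
    lets [E] be an event of another walk. *)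
Lemma P_hits E n K i z : (0 < n)%N -> measurable E -> indep_above E n i ->
  P (E `&` hits n K i z) = (P E * (hitp K z)%:E)%E.
Proof.
move=> n0; elim: K E i z => [|K IH] E i z mE EI.
  rewrite /=; case: ifPn => z0.
    rewrite mule1; congr (P _); apply/seteqP; split => w /=; first by case.
    by move=> Ew; split => //; left.
  rewrite mule0 -(measure0 P); congr (P _); apply/seteqP; split => w //=.
  by move=> [_ [zn|//]]; move/negP: z0.
have [z0|z0] := boolP (z < 0).
  rewrite /= z0 mule1; congr (P _); apply/seteqP; split => w /=; first by case.
  by move=> Ew; split => //; left.
(* Once the next coin is [c], there remains horizon [K] from the moved position, with the coin added
   to the past. *)
have step (c : bool) :
    P (E `&` hits n K.+1 i z `&` delta i.+1 n @^-1` [set c%:R]) =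
    (P E * (2^-1 * hitp K (z + (- ln 2 + c%:R * ln 5)))%:E)%E.
  rewrite EFinM muleA -(indep_above_delta c EI) -(IH _ i.+1); last 2 first.
  - by apply: measurableI => //; apply: measurable_delta_eq.
  - exact: indep_aboveS.
  congr (P _); rewrite setIAC; apply/seteqP; split => w /=.
    move=> [[Ew wc] [zn|H]]; first by move/negP: z0.
    by split => //; move: H; rewrite /RRW5_W wc.
  by move=> [[Ew wc] H]; split => //; right; rewrite /RRW5_W wc.
rewrite (P_split_delta (ltn0Sn i) n0); last first.
  by apply: measurableI => //; apply: measurable_hits.
rewrite !step /= (negPf z0) -ge0_muleDr; last 2 first.
- by rewrite lee_fin mulr_ge0 ?hitp_ge0.
- by rewrite lee_fin mulr_ge0 ?hitp_ge0.
by rewrite -EFinD -mulrDr mul0r mul1r addr0 addrA.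
Qed.

(** The coin lists of two walks are disjoint, so their cylinders merge into one cylinder whose
    probability factors. *)
Lemma indep_above_cyl L b n m : uniq L -> (0 < n)%N -> (0 < m)%N -> n != m ->
  (forall p, p \in L -> (0 < p.1)%N /\ p.2 = m) -> indep_above (cyl L b) n 0.
Proof.
move=> uL n0 m0 nm Lm L' b' uL' Ln.
have LL' p : p \in L -> p \notin L'.
  move=> /Lm[_ pm]; apply/negP => /Ln[_ pn].
  by move: nm; rewrite -pn pm eqxx.
pose c p := if p \in L then b p else b' p.
have -> : cyl L b `&` cyl L' b' = cyl (L ++ L') c.
  apply/seteqP; split => w /=.
    move=> [wL wL'] p; rewrite mem_cat /c.
    by case: ifPn => [/wL//|_/=]; exact: wL'.
  move=> H; split => p pL.
    by rewrite H ?mem_cat ?pL// /c pL.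
  rewrite H ?mem_cat ?pL ?orbT// /c ifF//.
  by apply/negP => /LL'; rewrite pL.
rewrite !P_cyl//; [by rewrite size_cat exprD EFinM|..].
- by move=> p /Lm[? ->].
- rewrite cat_uniq uL uL' andbT/=; apply/hasPn => p pL'.
  by apply/negP => /LL'; rewrite pL'.
- by move=> p; rewrite mem_cat => /orP[/Lm|/Ln] [? ->].
Qed.

Lemma indep_aboveT n : (0 < n)%N -> indep_above setT n 0.
Proof.
move=> n0 L b uL Ln; rewrite setTI probability_setT mul1e P_cyl//.
by move=> p /Ln[? ->].
Qed.

Lemma P_hits0 n K z : (0 < n)%N -> P (hits n K 0 z) = (hitp K z)%:E.
Proof.
move=> n0; have := P_hits K z n0 measurableT (indep_aboveT n0).
by rewrite setTI probability_setT mul1e.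
Qed.

(** The roles are swapped: [P_hits] is applied to walk [m] with a cylinder of walk [n] as its past.
    Applying it again, to walk [n] with the hitting event of [m] as past, yields [P_hitsI]. *)
Lemma indep_above_hits n m K z : (0 < n)%N -> (0 < m)%N -> n != m ->
  indep_above (hits m K 0 z) n 0.
Proof.
move=> n0 m0 nm L b uL Ln.
rewrite setIC P_hits//.
    by rewrite P_hits0// P_cyl 1?muleC// => p /Ln[? ->].
  exact: measurable_cyl.
by apply: (@indep_above_cyl _ _ _ n) => //; rewrite eq_sym.
Qed.

Lemma P_hitsI n m K z z' : (0 < n)%N -> (0 < m)%N -> n != m ->
  P (hits m K 0 z `&` hits n K 0 z') = (P (hits m K 0 z) * P (hits n K 0 z'))%E.
Proof.
move=> n0 m0 nm; rewrite P_hits ?P_hits0//; first exact: measurable_hits.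
exact: indep_above_hits.
Qed.

(** * Hitting at any time, by letting the horizon grow *)

Definition ever_hits n : set T := [set w | RRW5_S_infty delta w n].

Lemma ever_hitsE n : (0 < n)%N ->
  ever_hits n = \bigcup_K hits n K 0 (ln n%:R).
Proof.
move=> n0; apply/seteqP; split => w.
  move=> [_ [k [k0]]]; rewrite expR_lt1 => Zk; exists k => //.
  by apply/hitsP; exists k => //; move: Zk; rewrite /RRW5_Z big_add1 add0n.
move=> [K _ /hitsP[k kK]]; rewrite add0n => H; split => //; exists k.
rewrite expR_lt1 /RRW5_Z big_add1/=; split => //.
(* [RRW5_S_infty] requires a time at least 1 while [hits] also allows time 0; the walk starts at
   [ln n >= 0], so time 0 never hits. *)
case: k {kK} H => //; rewrite big_geq// addr0 ltNge ln_ge0//.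
by rewrite ler1n.
Qed.

Lemma hits_nondecreasing n z :
  {homo (fun K => hits n K 0 z) : K K' / (K <= K')%N >-> (K <= K')%O}.
Proof.
move=> K K' KK'; apply/subsetPset => w /hitsP[k kK H].
by apply/hitsP; exists k => //; apply: leq_trans KK'.
Qed.

Lemma measurable_ever_hits n : measurable (ever_hits n).
Proof.
case: n => [|n].
  rewrite (_ : ever_hits 0 = set0)//; apply/seteqP.
  by split => w //= -[].
by rewrite ever_hitsE//; apply: bigcupT_measurable => K; apply: measurable_hits.
Qed.

Lemma cvg_hits n : (0 < n)%N ->
  P (hits n K 0 (ln n%:R)) @[K --> \oo] --> P (ever_hits n).
Proof.
move=> n0; rewrite ever_hitsE//; apply: nondecreasing_cvg_mu.
- by move=> K; apply: measurable_hits.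
- by apply: bigcupT_measurable => K; apply: measurable_hits.
- exact: hits_nondecreasing.
Qed.

(** The product rule at a common horizon [K] passes to the limit by continuity from below. *)
Lemma P_ever_hitsI n m : (0 < n)%N -> (0 < m)%N -> n != m ->
  P (ever_hits m `&` ever_hits n) = (P (ever_hits m) * P (ever_hits n))%E.
Proof.
move=> n0 m0 nm.
have h1 : (P (hits m K 0 (ln m%:R)) * P (hits n K 0 (ln n%:R)))%E @[K --> \oo]
    --> (P (ever_hits m) * P (ever_hits n))%E.
  apply: cvgeM; [|exact: cvg_hits|exact: cvg_hits].
  by rewrite mule_def_fin// fin_num_measure//; apply: measurable_ever_hits.
have h2 : P (hits m K 0 (ln m%:R) `&` hits n K 0 (ln n%:R)) @[K --> \oo]
    --> P (ever_hits m `&` ever_hits n).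
  have -> : ever_hits m `&` ever_hits n =
      \bigcup_K (hits m K 0 (ln m%:R) `&` hits n K 0 (ln n%:R)).
    rewrite !ever_hitsE//; apply/seteqP; split => w.
      move=> [[K _ HK] [K' _ HK']]; exists (maxn K K') => //; split.
        have /subsetPset := hits_nondecreasing m (ln m%:R) (leq_maxl K K').
        exact.
      have /subsetPset := hits_nondecreasing n (ln n%:R) (leq_maxr K K').
      exact.
    by move=> [K _ [? ?]]; split; exists K.
  apply: nondecreasing_cvg_mu.
  - by move=> K; apply: measurableI; apply: measurable_hits.
  - apply: bigcupT_measurable => K.
    by apply: measurableI; apply: measurable_hits.
  - move=> K K' KK'; apply/subsetPset => w [].
    move: (hits_nondecreasing m (ln m%:R) KK') => /subsetPset H1 /H1 H1'.
    move: (hits_nondecreasing n (ln n%:R) KK') => /subsetPset H2 /H2 H2'.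
    by [].
rewrite -(cvg_lim (@ereal_hausdorff R) h2) -(cvg_lim (@ereal_hausdorff R) h1).
by congr (lim (_ @ \oo)); apply/funext => K; rewrite P_hitsI.
Qed.

Definition hit_prob n : R := fine (P (ever_hits n)).

Lemma hit_probE n : P (ever_hits n) = (hit_prob n)%:E.
Proof. by rewrite fineK// fin_num_measure//; apply: measurable_ever_hits. Qed.

Lemma cvg_hitp n : (0 < n)%N ->
  hitp K (ln n%:R) @[K --> \oo] --> hit_prob n.
Proof.
move=> n0; have := cvg_hits n0; rewrite hit_probE => /fine_cvg.
apply: cvg_trans; apply: near_eq_cvg; apply: nearW => K /=.
by rewrite P_hits0.
Qed.

Lemma powR_natN n (t : R) : (0 < n)%N -> expR (- t * ln n%:R) = n%:R `^ (- t).
Proof. by move=> n0; rewrite /powR pnatr_eq0 gtn_eqF. Qed.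

Lemma hit_prob_le t n : (0 < n)%N -> 0 <= t -> step_mgf t = 1 ->
  hit_prob n <= n%:R `^ (- t).
Proof.
move=> n0 t0 t1; apply: (cvgr_to_le (cvg_hitp n0)).
by apply: nearW => K; rewrite -powR_natN//; apply: hitp_le.
Qed.

Lemma hit_prob_ge t n : (0 < n)%N -> 0 < t -> step_mgf t = 1 ->
  n%:R `^ (- t) <= 2 `^ t * hit_prob n.
Proof.
(* Any [s] strictly between 0 and [t] would do: [step_mgf s < 1] makes the error term of [hitp_ge]
   vanish as [K] grows. *)
move=> n0 t0 t1; pose s := t / 2.
have s0t : 0 < s < t by rewrite /s; lra.
have s1 := step_mgf_lt1 t1 s0t.
have s0 : 0 <= step_mgf s by rewrite mulr_ge0 ?addr_ge0 ?powR_ge0 ?invr_ge0.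
have lim : 2 `^ t * hitp K (ln n%:R) + step_mgf s ^+ K * expR (- s * ln n%:R)
    @[K --> \oo] --> 2 `^ t * hit_prob n + 0 * expR (- s * ln n%:R).
  apply: cvgD; first by apply: cvgMr; apply: cvg_hitp.
  by apply: cvgMl; apply: cvg_expr; rewrite ger0_norm.
rewrite mul0r addr0 in lim; apply: (cvgr_to_ge lim).
apply: nearW => K; rewrite -powR_natN//; apply: hitp_ge => //.
  by case/andP: s0t => ? /ltW ->; rewrite ltW.
by rewrite (@le_trans _ _ 0)// ?oppr_le0 ?ln_ge0 ?ler1n// ltW// ln2_gt0.
Qed.

End walk.

(** * A second moment bound for pairwise independent events *)

Section pairwise_independent_events.
Context (d : measure_display) (T : measurableType d) (R : realType)
  (P : probability T R).
Context (I : eqType) (A : I -> set T).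
Hypothesis mA : forall i, measurable (A i).
Implicit Type s : seq I.

Let p i : R := fine (P (A i)).

Definition count_events s : T -> R := \sum_(i <- s) \1_(A i).

Let PA i : P (A i) = (p i)%:E.
Proof. by rewrite fineK// fin_num_measure. Qed.

Lemma Lfun2_indic (B : set T) : measurable B -> (\1_B : T -> R) \in Lfun P 2%:E.
Proof.
move=> mB; rewrite inE/=; apply/andP; split; rewrite inE//=.
rewrite /finite_norm unlock poweR_lty//.
under eq_integral => x _.
  rewrite (_ : `|(\1_B x : R)|%:E `^ 2 = (\1_B x)%:E)%E; last first.
    rewrite poweR_EFin indicE; case: (_ \in _); rewrite ?normr1 ?normr0.
      by rewrite powR1.
    by rewrite powR0// pnatr_eq0.
  over.
by rewrite integral_indic// setIT ltey_eq fin_num_measure.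
Qed.

Lemma Lfun2_count_events s : count_events s \in Lfun P 2%:E.
Proof.
rewrite /count_events; apply: rpred_sum => [|? i _]; first by rewrite lee1n.
exact: Lfun2_indic.
Qed.

Lemma Lfun2_Lfun1 (X : T -> R) : X \in Lfun P 2%:E -> X \in Lfun P 1%E.
Proof. by apply: Lfun_subset12; rewrite fin_num_measure. Qed.

Lemma count_events_cons i s :
  count_events (i :: s) = (\1_(A i) \+ count_events s)%R.
Proof. by rewrite /count_events big_cons. Qed.

Lemma expectation_count_events s :
  'E_P[count_events s]%E = (\sum_(i <- s) p i)%:E.
Proof.
elim: s => [|i s IH].
  by rewrite /count_events !big_nil expectation_cst.
rewrite count_events_cons expectationD.
- by rewrite IH expectation_indic// big_cons EFinD PA.
- exact/Lfun2_Lfun1/Lfun2_indic.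
- exact/Lfun2_Lfun1/Lfun2_count_events.
Qed.

Lemma covariance_indic (B C : set T) : measurable B -> measurable C ->
  covariance P \1_B \1_C = (P (B `&` C) - P B * P C)%E.
Proof.
move=> mB mC; rewrite covarianceE.
- rewrite !expectation_indic// (_ : (\1_B * \1_C)%R = \1_(B `&` C)); last first.
    by rewrite indicI.
  by rewrite expectation_indic//; apply: measurableI.
- exact/Lfun2_Lfun1/Lfun2_indic.
- exact/Lfun2_Lfun1/Lfun2_indic.
- exact: Lfun2_mul_Lfun1 (Lfun2_indic mB) (Lfun2_indic mC).
Qed.

Lemma covariance_indic_count_events i s :
  (forall j, j \in s -> P (A i `&` A j) = (P (A i) * P (A j))%E) ->
  covariance P \1_(A i) (count_events s) = 0%E.
Proof.
elim: s => [|j s IH] Hs.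
  by rewrite /count_events big_nil covariance_cst_r.
rewrite count_events_cons covarianceDr ?Lfun2_indic ?Lfun2_count_events//.
rewrite covariance_indic// Hs ?mem_head// IH.
  by rewrite adde0 subee// !PA.
by move=> k ks; apply: Hs; rewrite inE ks orbT.
Qed.

(** Pairwise independence kills the covariances, and one indicator contributes [p - p ^ 2], at most
    [p]. *)
Lemma variance_count_events_le s : uniq s ->
  {in s &, forall i j, i != j -> P (A i `&` A j) = (P (A i) * P (A j))%E} ->
  ('V_P[count_events s] <= (\sum_(i <- s) p i)%:E)%E.
Proof.
elim: s => [|i s IH] /=.
  by move=> _ _; rewrite /count_events !big_nil variance_cst.
move=> /andP[si us] Hs.
rewrite count_events_cons varianceD ?Lfun2_indic ?Lfun2_count_events//.
rewrite covariance_indic_count_events ?mule0 ?adde0; last first.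
  move=> j js; apply: Hs; rewrite ?inE ?eqxx ?js ?orbT//.
  by apply: contraNneq si => ->.
rewrite big_cons EFinD leeD ?IH//; last first.
  by move=> j k js ks; apply: Hs; rewrite inE ?js ?ks orbT.
rewrite /variance covariance_indic// setIid PA -EFinM -EFinB lee_fin.
by rewrite gerBl -expr2 sqr_ge0.
Qed.

Lemma measurable_count_events s : measurable_fun setT (count_events s).
Proof.
have -> : count_events s = (fun w => \sum_(i <- s) \1_(A i) w).
  by apply/funext => w; rewrite /count_events fct_sumE.
by apply: measurable_sum => i; apply: measurable_indic.
Qed.

(** Off this event the count lies strictly between one half and three halves of its mean. *)
Definition deviates s : set T :=
  [set w | (\sum_(i <- s) p i) / 2 <= `|count_events s w - \sum_(i <- s) p i|].

Lemma measurable_deviates s : measurable (deviates s).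
Proof.
rewrite /deviates -[X in measurable X]setTI.
apply: measurable_fun_ler => //.
apply: measurableT_comp => //; apply: measurable_funB => //.
exact: measurable_count_events.
Qed.

(** Chebyshev at distance [m / 2] with variance at most the mean [m] gives
    [m / (m / 2) ^ 2 = 4 / m]. *)
Lemma P_deviates_le s : uniq s ->
  {in s &, forall i j, i != j -> P (A i `&` A j) = (P (A i) * P (A j))%E} ->
  0 < \sum_(i <- s) p i ->
  (P (deviates s) <= (4 / \sum_(i <- s) p i)%:E)%E.
Proof.
move=> us Hs m0; have mX : count_events s \in mfun.
  by rewrite inE/=; apply: measurable_count_events.
have e0 : 0 < (\sum_(i <- s) p i) / 2 by rewrite divr_gt0.
have := @chebyshev _ _ _ P (mfun_Sub mX) _ e0.
rewrite /= expectation_count_events/= => /le_trans; apply.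
apply: (@le_trans _ _
  ((((\sum_(i <- s) p i) / 2) ^- 2)%:E * (\sum_(i <- s) p i)%:E)%E).
  rewrite lee_pmul2l ?lte_fin ?invr_gt0 ?exprn_gt0//.
  exact: variance_count_events_le.
rewrite -EFinM lee_fin; set m := \sum_(_ <- _) _ in m0 *.
by rewrite le_eqVlt; apply/orP; left; apply/eqP; field; rewrite gt_eqF.
Qed.

End pairwise_independent_events.

(** * Power sums with exponent between -1 and 0 *)

Section power_sums.
Context {R : realType}.
Implicit Types (eta : R) (N : nat).

(** Concavity: the increment dominates the derivative at the right end. The chord inequality at
    [ln (n / m)] bounds the [eta]-th power of [n / m] by [1 - eta + eta * (n / m)]. *)
Lemma powR_natS_sub eta N : 0 < eta < 1 ->
  eta * N.+1%:R `^ (eta - 1) <= N.+1%:R `^ eta - N%:R `^ eta.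
Proof.
move=> /andP[e0 e1]; have S0 : 0 < N.+1%:R :> R by rewrite ltr0n.
have -> : N.+1%:R `^ (eta - 1) = N.+1%:R `^ eta / N.+1%:R :> R.
  by rewrite powRB ?powRr1// pnatr_eq0 implybT.
(* For [N = 0] the ratio is 0 and has no logarithm to work with, so this case is computed
   directly. *)
case: N S0 => [|N] S0.
  by rewrite powR0 ?gt_eqF// powR1 subr0 divr1 mulr1 ltW.
have N0 : 0 < N.+1%:R :> R by rewrite ltr0n.
set n := N.+1%:R in N0 *; set m := N.+2%:R in S0 *.
have mn : m = n + 1 by rewrite /m /n -natr1.
have q0 : 0 < n / m by rewrite divr_gt0.
have q1 : n / m < 1 by rewrite ltr_pdivrMr// mul1r mn ltrDl.
have e01 : 0 < eta < 1 by rewrite e0.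
have /(expR_lt_chord)/(_ e01) : ln (n / m) != 0 by rewrite lt_eqF// ln_lt0// q0.
rewrite lnK ?posrE// => /ltW chord.
have -> : n `^ eta = m `^ eta * expR (eta * ln (n / m)).
  rewrite /powR !gt_eqF// -expRD lnM ?posrE ?invr_gt0// lnV ?posrE//.
  by congr expR; ring.
have : m `^ eta * expR (eta * ln (n / m)) <=
    m `^ eta * (1 - eta + eta * (n / m)) by rewrite ler_pM2l ?powR_gt0.
have -> : n / m = 1 - m^-1.
  have -> : n = m - 1 by rewrite mn addrK.
  by rewrite mulrBl mul1r divff ?gt_eqF.
move: (m^-1) (m `^ eta) (expR _) => r X Y; lra.
Qed.

Lemma sum_powR_le eta N : 0 < eta < 1 ->
  \sum_(n <- iota 1 N) n%:R `^ (eta - 1) <= eta^-1 * N%:R `^ eta.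
Proof.
move=> e01; have e0 : 0 < eta by case/andP: e01.
elim: N => [|N IH]; first by rewrite big_nil mulr_ge0 ?powR_ge0 ?invr_ge0 ?ltW.
have -> : iota 1 N.+1 = iota 1 N ++ [:: N.+1].
  by rewrite -[in LHS](addn1 N) iotaD add1n.
rewrite big_cat big_seq1/=.
rewrite -(ler_pM2l e0) mulrDr mulrA divff ?gt_eqF// mul1r.
rewrite -(ler_pM2l e0) mulrA divff ?gt_eqF// mul1r in IH.
have := powR_natS_sub N e01; lra.
Qed.

(** The exponent is negative, so each of the [N] summands is at least the last one. *)
Lemma sum_powR_ge eta N : 0 < eta < 1 ->
  N%:R `^ eta <= \sum_(n <- iota 1 N) n%:R `^ (eta - 1).
Proof.
move=> /andP[e0 e1]; case: N => [|N].
  by rewrite big_nil powR0// gt_eqF.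
have -> : N.+1%:R `^ eta = \sum_(n <- iota 1 N.+1) N.+1%:R `^ (eta - 1) :> R.
  rewrite big_const_seq count_predT size_iota iter_addr_0 -[RHS]mulr_natr.
  by rewrite -{3}[N.+1%:R]powRr1// -powRD ?subrK// pnatr_eq0/= implybT.
rewrite !big_seq; apply: ler_sum => n; rewrite mem_iota add1n => /andP[n0 nN].
rewrite -opprB !powRN lef_pV2 ?posrE ?powR_gt0 ?ltr0n//.
by rewrite ge0_ler_powR ?nnegrE ?ler_nat ?subr_ge0// ltW.
Qed.

End power_sums.

(** * Geometric domination and limits of logarithmic ratios *)

Lemma nneseries_geometric_lty {R : realType} (u : nat -> \bar R) (a q : R) :
  (forall n, 0 <= u n)%E -> (forall n, u n <= (a * q ^+ n)%:E)%E ->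
  0 <= a -> 0 <= q < 1 -> (\sum_(n <oo) u n < +oo)%E.
Proof.
move=> u0 ua a0 /andP[q0 q1].
apply: (@le_lt_trans _ _ (a / (1 - q))%:E); last exact: ltry.
apply: lime_le; first by apply: is_cvg_nneseries.
apply: nearW => n; apply: (@le_trans _ _ (\sum_(0 <= i < n) (a * q ^+ i)%:E)%E).
  by apply: lee_sum => i _; apply: ua.
rewrite sumEFin lee_fin.
have := geometric_seriesE a (negbT (lt_eqF q1)) => /(congr1 (fun f => f n)).
rewrite /series/= => ->; rewrite ler_pM2r ?invr_gt0 ?subr_gt0//.
by rewrite ler_piMr// gerBl exprn_ge0.
Qed.

(** After taking logarithms the constants [c] and [C] are bounded errors, which division by [ln x]
    sends to 0. *)
Lemma cvg_ln_ratio {R : realType} (f : R -> R) (c C eta : R) : 0 < c ->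
  (\forall x \near +oo, c * x `^ eta <= f x <= C * x `^ eta) ->
  ln (f x) / ln x @[x --> +oo] --> eta.
Proof.
move=> c0 fcC; apply/cvgrPdist_le => e e0.
pose M := Num.max `|ln c| `|ln C|.
near=> x.
have x1 : 1 < x by near: x; apply: nbhs_pinfty_gt.
have x0 : 0 < x by apply: lt_trans x1.
have lx0 : 0 < ln x by rewrite ln_gt0.
have Mx : M <= e * ln x.
  by rewrite -ler_pdivrMl// -[leLHS]expRK ler_ln ?posrE ?expR_gt0//.
have /andP[cf fC] : c * x `^ eta <= f x <= C * x `^ eta by near: x.
have X0 := powR_gt0 eta x0.
have f0 : 0 < f x by apply: lt_le_trans cf; rewrite mulr_gt0.
have C0 : 0 < C by rewrite -(pmulr_lgt0 _ X0); apply: lt_le_trans fC.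
have -> : eta - ln (f x) / ln x = (eta * ln x - ln (f x)) / ln x.
  by field; rewrite gt_eqF.
rewrite normrM normfV (gtr0_norm lx0) ler_pdivrMr//.
apply: le_trans Mx; rewrite ler_norml.
have h1 : ln c + eta * ln x <= ln (f x).
  by rewrite -ln_powR -lnM ?posrE// ler_ln ?posrE// mulr_gt0.
have h2 : ln (f x) <= ln C + eta * ln x.
  by rewrite -ln_powR -lnM ?posrE// ler_ln ?posrE// mulr_gt0.
have hc : `|ln c| <= M by rewrite le_max lexx.
have hC : `|ln C| <= M by rewrite le_max lexx orbT.
move: hc hC; rewrite !ler_norml => /andP[hc1 hc2] /andP[hC1 hC2].
apply/andP; split; lra.
Unshelve. all: by end_near.
Qed.

(** * The counting function and its values at powers of two *)

Section counting.
Context (d : measure_display) (T : measurableType d) (R : realType)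
  (P : probability T R) (delta : nat -> nat -> {RV P >-> R}).

Local Notation pi := (RRW5_pi delta).
Local Notation hit_count N := (count_events R (ever_hits delta) (iota 1 N)).

Let counted (x : R) w : set nat :=
  [set n | (1 <= n)%N /\ n%:R <= x /\ RRW5_S_infty delta w n].

Let counted_natE N w :
  counted N%:R w =
  [set` [fset n in [seq n <- iota 1 N | w \in ever_hits delta n]]%fset].
Proof.
apply/seteqP; split => n /=.
  move=> [n1 [nN Sn]]; rewrite !inE/= mem_filter mem_iota n1 add1n ltnS.
  by rewrite -(ler_nat R) nN andbT andbT; apply/mem_set.
rewrite !inE/= mem_filter mem_iota add1n ltnS.
move=> /andP[/set_mem Sn /andP[n1 nN]].
by split => //; split => //; rewrite ler_nat.
Qed.

Lemma RRW5_pi_nat N w : (pi N%:R w)%:R = hit_count N w.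
Proof.
rewrite /RRW5_pi -/(counted _ _) counted_natE set_fsetK card_fseq.
rewrite undup_id; last first.
  by rewrite filter_uniq// iota_uniq.
rewrite size_filter /count_events fct_sumE -sum1_count natr_sum big_mkcond.
by apply: eq_bigr => n _; rewrite indicE; case: (_ \in _).
Qed.

Lemma RRW5_pi_le (x y : R) w : x <= y -> (pi x w <= pi y w)%N.
Proof.
(* Finiteness is needed because [fset_set] takes a default value on infinite sets. *)
move=> xy; have fin z : finite_set (counted z w).
  have [N zN] : exists N : nat, z <= N%:R.
    by exists (Num.trunc z).+1; apply: ltW; apply: truncnS_gt.
  apply: (@sub_finite_set _ _ (counted N%:R w)).
    by move=> n [n1 [nz Sn]]; split => //; split => //; apply: le_trans zN.
  by rewrite counted_natE; apply: finite_fset.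
apply: fsubset_leq_card; rewrite -fset_set_sub//; [|exact: fin|exact: fin].
by move=> n [n1 [nx Sn]]; split => //; split => //; apply: le_trans xy.
Qed.

Lemma dyadic_between (x : R) : 1 <= x ->
  exists j, (2 ^ j)%:R <= x < (2 ^ j.+1)%:R.
Proof.
move=> x1; have x0 : 0 <= x by apply: le_trans x1.
have /andP[tx xt] := truncn_itv x0.
have t0 : (0 < Num.trunc x)%N.
  by rewrite lt0n; apply: contraTneq xt => ->; rewrite -leNgt.
have /andP[h1 h2] := trunc_log_bounds (ltnSn 1) t0.
exists (trunc_log 2 (Num.trunc x)); apply/andP; split.
  by apply: le_trans tx; rewrite ler_nat.
by apply: lt_le_trans xt _; rewrite ler_nat.
Qed.

Lemma cvg_ln_RRW5_pi w (c C eta : R) : 0 < c -> 0 <= C -> 0 < eta ->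
  (\forall j \near \oo, c * (2 ^ j)%:R `^ eta <= hit_count (2 ^ j) w
     <= C * (2 ^ j)%:R `^ eta) ->
  ln (pi x w)%:R / ln x @[x --> +oo] --> eta.
Proof.
move=> c0 C0 e0 [J _ HJ].
apply: (@cvg_ln_ratio _ _ (c / 2 `^ eta) (C * 2 `^ eta)).
  by rewrite divr_gt0 ?powR_gt0.
near=> x.
have xJ : (2 ^ J)%:R <= x by near: x; apply: nbhs_pinfty_ge; rewrite num_real.
have x1 : 1 <= x by apply: le_trans xJ; rewrite ler1n expn_gt0.
have x0 : 0 <= x by apply: le_trans x1.
have [j /andP[jx xj]] := dyadic_between x1.
have Jj : (J <= j)%N.
  by rewrite -ltnS -(@ltn_exp2l 2)// -(ltr_nat R); apply: le_lt_trans xJ xj.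
have /= /andP[lo _] := HJ j Jj.
have /= /andP[_ hi] := HJ j.+1 (leqW Jj).
have e2 : (2 ^ j.+1)%:R = 2 * (2 ^ j)%:R :> R by rewrite expnS natrM.
apply/andP; split.
  apply: (@le_trans _ _ (pi (2 ^ j)%:R w)%:R); last first.
    by rewrite ler_nat RRW5_pi_le.
  rewrite RRW5_pi_nat; apply: le_trans lo; rewrite -mulrA ler_pM2l//.
  rewrite mulrC ler_pdivrMr ?powR_gt0// -powRM//.
  by rewrite ge0_ler_powR ?nnegrE ?mulr_ge0 ?(ltW e0)// mulrC -e2 ltW.
apply: (@le_trans _ _ (pi (2 ^ j.+1)%:R w)%:R).
  by rewrite ler_nat RRW5_pi_le ?ltW.
rewrite RRW5_pi_nat; apply: (le_trans hi); rewrite -mulrA ler_wpM2l// -powRM//.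
by rewrite ge0_ler_powR ?nnegrE ?mulr_ge0 ?(ltW e0)// e2 ler_pM2l.
Unshelve. all: by end_near.
Qed.

(** * Size of the mean and almost sure control of the deviations *)

Hypothesis hdelta : RRW5_model delta.
Variable theta : R.
Hypotheses (theta01 : 0 < theta < 1) (thetaE : step_mgf theta = 1).

Local Notation eta := (1 - theta).
Local Notation mean N := (\sum_(n <- iota 1 N) hit_prob delta n).

Let eta01 : 0 < eta < 1.
Proof. by case/andP: theta01 => ? ?; rewrite subr_gt0 gtrBl; apply/andP. Qed.

Let etaB1 : eta - 1 = - theta. Proof. by ring. Qed.

Lemma mean_le N : mean N <= eta^-1 * N%:R `^ eta.
Proof.
apply: le_trans (sum_powR_le N eta01); rewrite !big_seq; apply: ler_sum => n.
rewrite mem_iota => /andP[n0 _]; rewrite etaB1; case/andP: theta01 => t0 _.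
by apply: hit_prob_le => //; apply: ltW.
Qed.

Lemma mean_ge N : (2 `^ theta)^-1 * N%:R `^ eta <= mean N.
Proof.
rewrite ler_pdivrMl ?powR_gt0//; apply: (le_trans (sum_powR_ge N eta01)).
rewrite mulr_sumr !big_seq; apply: ler_sum => n.
rewrite mem_iota => /andP[n0 _]; rewrite etaB1; case/andP: theta01 => t0 _.
exact: hit_prob_ge.
Qed.

Definition dyadic_deviates j := deviates P (ever_hits delta) (iota 1 (2 ^ j)).

Lemma P_dyadic_deviates_le j :
  (P (dyadic_deviates j) <= (4 * 2 `^ theta * (2 `^ (- eta)) ^+ j)%:E)%E.
Proof.
have N0 : (0 : R) < (2 ^ j)%:R by rewrite ltr0n expn_gt0.
have m0 : 0 < (2 `^ theta)^-1 * (2 ^ j)%:R `^ eta.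
  by rewrite mulr_gt0 ?invr_gt0 ?powR_gt0.
have mj : 0 < mean (2 ^ j) by apply: lt_le_trans (mean_ge _).
apply: (@le_trans _ _ (4 / mean (2 ^ j))%:E).
  apply: P_deviates_le => //; [exact: measurable_ever_hits|exact: iota_uniq|].
  move=> n m; rewrite !mem_iota => /andP[n0 _] /andP[m0' _] nm.
  by apply: P_ever_hitsI; rewrite // eq_sym.
rewrite lee_fin -mulrA ler_pM2l//.
have -> : 2 `^ theta * 2 `^ (- eta) ^+ j =
    ((2 `^ theta)^-1 * (2 ^ j)%:R `^ eta)^-1.
  rewrite invfM invrK; congr (_ * _).
  rewrite natrX -!powR_mulrn ?powR_ge0// -!powRrM mulrC -powRN.
  by congr powR; ring.
by rewrite lef_pV2 ?posrE// mean_ge.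
Qed.

Lemma negligible_dyadic_deviates : P.-negligible (lim_sup_set dyadic_deviates).
Proof.
have mdev j : measurable (dyadic_deviates j).
  by apply: measurable_deviates; apply: measurable_ever_hits.
exists (lim_sup_set dyadic_deviates); split => //.
  by apply: bigcapT_measurable => n; apply: bigcup_measurable.
apply: lim_sup_set_cvg0 => //.
apply: (@nneseries_geometric_lty _ _ (4 * 2 `^ theta) (2 `^ (- eta))) => //.
- exact: P_dyadic_deviates_le.
(* The ratio is below 1 because [eta] is positive, that is, because [theta < 1]. *)
rewrite powR_ge0/= powR2E expR_lt1 mulNr oppr_lt0 mulr_gt0 ?ln2_gt0//.
by case/andP: eta01.
Qed.

Lemma ae_cvg_ln_RRW5_pi :
  {ae P, forall w, ln (pi x w)%:R / ln x @[x --> +oo] --> eta}.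
Proof.
apply: negligibleS negligible_dyadic_deviates => w /= nw; apply: contrapT => nb.
apply: nw; have [e0 e1] := andP eta01.
(* The factors 1/2 and 3/2 come from [deviates], the other two from [mean_ge] and [mean_le]. *)
apply: (@cvg_ln_RRW5_pi _ (2^-1 * (2 `^ theta)^-1) (3 / 2 * eta^-1)) => //.
  by rewrite mulr_ge0 ?divr_ge0 ?invr_ge0 ?(ltW e0).
(* Outside the limit superior, only finitely many deviations occur. *)
have [J HJ] : exists J, forall j, (J <= j)%N -> ~ dyadic_deviates j w.
  apply: contrapT => H; apply: nb => J _.
  apply: contrapT => HJ; apply: H; exists J => j Jj bj.
  by apply: HJ; exists j.
exists J => //= j /= Jj; have /negP := HJ j Jj; rewrite -ltNge.
rewrite -/(mean _) ltr_norml => /andP[h1 h2].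
have := mean_le (2 ^ j); have := mean_ge (2 ^ j).
set X := hit_count _ _ in h1 h2 *; set m := mean _ in h1 h2 *.
rewrite -!mulrA.
set u := _^-1 * _; set v := _ * _.
move=> hu hv; apply/andP; split; lra.
Qed.

End counting.

Theorem theorem8p5 (d : measure_display) (T : measurableType d) (R : realType)
    (P : probability T R) (delta : nat -> nat -> {RV P >-> R})
    (hdelta : RRW5_model delta) :
  exists theta : R,
    unique (@RRW5_theta_eq R) theta /\
    {ae P, forall w : T,
      ln (RRW5_pi delta x w)%:R / ln x @[x --> +oo] --> 1 - theta}.
Proof.
(* The root is found in the unit interval, as the counting argument needs; uniqueness is then proved
   among all positive reals. *)
have [theta theta01 thetaE] := @ex_step_mgf_eq1 R.
have [theta0 _] := andP theta01.
exists theta; split; last exact: ae_cvg_ln_RRW5_pi.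
split; first by split.
by move=> t [t0 t1]; apply: unique_step_mgf_eq1.
Qed.
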